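(* If $\Gamma\vdash_{\mathcal{AF}2S}t:A$ and $t\to_\eta t'$, then $\Gamma\vdash_{\mathcal{AF}2S}t':A$.
   Context: $\lambda$-terms are pure $\lambda$-terms (up to renaming of bound variables); $(t)u$ is application; $\to_\eta$ is many-step $\eta$-reduction (generated by contracting $\lambda x(t)x$ to $t$ when $x$ is not free in $t$). Formulas. Fix a second-order language $L$ (function symbols, predicate symbols) and a set $E$ of equations $t=t'$ between terms of $L$. Formulas (types) are built from atomic formulas ($\perp$, $P(t_1,\ldots,t_n)$ with $P$ an $n$-ary predicate symbol, $X(t_1,\ldots,t_n)$ with $X$ an $n$-ary predicate variable, $n\ge 0$) using $\to$ and $\forall$ over individual (first-order) variables $x$ and predicate (second-order) variables $X$. Formulas are taken up to renaming of bound variables. $A[u/x]$ is substitution of a term; $A[G/X]$ is obtained by replacing each atomic formula $X(t_1,\ldots,t_n)$ of $A$ by $G[t_1/x_1,\ldots,t_n/x_n]$ (for chosen variables $x_1,\ldots,x_n$). A particular case of an equation $t=t'$ is $t[u_1/x_1,\ldots]=t'[u_1/x_1,\ldots]$ or $t'[u_1/x_1,\ldots]=t[u_1/x_1,\ldots]$, with $u_i$ terms. A context $\Gamma$ is a set $x_1:A_1,\ldots,x_n:A_n$ with distinct $\lambda$-variables $x_i$. $\xi$ denotes a first- or second-order variable, $\boldsymbol\xi=\xi_1,\ldots,\xi_n$ a finite (possibly empty) sequence of such variables, $\forall\boldsymbol\xi A=\forall\xi_1\ldots\forall\xi_n A$; $\boldsymbol\xi$ is not free in $\Gamma$ if no $\xi_i$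 is free in a formula of $\Gamma$. The relation $A\subseteq B$ on formulas is generated by: $(ax')$ $A\subseteq A$; $(dist)$ $\forall\xi(C\to D)\subseteq\forall\xi C\to\forall\xi D$; $(\to)$ if $C'\subseteq C$ and $D\subseteq D'$ then $C\to D\subseteq C'\to D'$; $(\forall_e)$ if $A\subseteq\forall\xi C$ then $A\subseteq C[F/\xi]$ ($F$ a term if $\xi$ is first-order, a formula if $\xi$ is second-order); $(\forall_i)$ if $A\subseteq D$ and $\xi$ is not free in $A$ then $A\subseteq\forall\xi D$; $(tr)$ if $A\subseteq D$ and $D\subseteq B$ then $A\subseteq B$; $(e)$ if $A\subseteq D[u/y]$ and $u=v$ is a particular case of an equation of $E$ then $A\subseteq D[v/y]$. System $\mathcal{AF}2S$ (with $\boldsymbol\xi$ not free in $\Gamma$ in each rule): (S1) if $x:B\in\Gamma$ and $\forall\boldsymbol\xi B\subseteq A$ then $\Gamma\vdash x:A$; (S2) if $\Gamma,x:B\vdash u:C$ and $\forall\boldsymbol\xi(B\to C)\subseteq A$ then $\Gamma\vdash\lambda xu:A$; (S3) if $\Gamma\vdash u:B\to C$, $\Gamma\vdash v:B$ and $\forall\boldsymbol\xi C\subseteq A$ then $\Gamma\vdash(u)v:A$. *)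

(* Defs.v *)
From Stdlib Require Import Arith List Relations.
From Stdlib Require Vector.

Set Implicit Arguments.

(** Lambda-terms and formulas are represented with de Bruijn indices, so that
    syntactic equality is equality up to renaming of bound variables. *)

(** * Pure lambda-terms and eta-reduction *)

Inductive lterm : Type :=
| LVar (x : nat)
| LLam (u : lterm)
| LApp (u v : lterm).

Definition up_ren (r : nat -> nat) (i : nat) : nat :=
  match i with 0 => 0 | S j => S (r j) end.

Fixpoint lrename (r : nat -> nat) (t : lterm) : lterm :=
  match t with
  | LVar x => LVar (r x)
  | LLam u => LLam (lrename (up_ren r) u)
  | LApp u v => LApp (lrename r u) (lrename r v)
  end.

(** In [eta_contract], "x is not free in t" is expressed by the body being the
    weakening of [t] applied to the bound variable. *)
Inductive eta_step : lterm -> lterm -> Prop :=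
| eta_contract t : eta_step (LLam (LApp (lrename S t) (LVar 0))) t
| eta_lam u u' : eta_step u u' -> eta_step (LLam u) (LLam u')
| eta_app_l u u' v : eta_step u u' -> eta_step (LApp u v) (LApp u' v)
| eta_app_r u v v' : eta_step v v' -> eta_step (LApp u v) (LApp u v').

Definition eta_red : lterm -> lterm -> Prop := clos_refl_trans lterm eta_step.

(** * Second-order formulas *)

Record language : Type := Language {
  fsym : Type;
  farity : fsym -> nat;
  psym : Type;
  parity : psym -> nat
}.

Inductive term (L : language) : Type :=
| Var (i : nat)
| Fun (f : fsym L) (ts : Vector.t (term L) (farity L f)).

Arguments Var {L} i.
Arguments Fun {L} f ts.

(** The sort of a variable: first-order, or second-order of a given arity. *)
Inductive sort : Type :=
| Ind
| Prd (n : nat).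

(** Every sort has its own de Bruijn indices: [All k A] binds index 0 of sort
    [k] in [A] and leaves the indices of all other sorts, in particular those
    of predicate variables of other arities, untouched. *)
Inductive formula (L : language) : Type :=
| Bot
| Pred (P : psym L) (ts : Vector.t (term L) (parity L P))
| PVar (n : nat) (X : nat) (ts : Vector.t (term L) n)
| Arr (A B : formula L)
| All (k : sort) (A : formula L).

Arguments Bot {L}.
Arguments Pred {L} P ts.
Arguments PVar {L} n X ts.
Arguments Arr {L} A B.
Arguments All {L} k A.

Section Formulas.

Context {L : language}.

(** ** Substitution of terms for individual variables *)

Fixpoint tsubst (s : nat -> term L) (t : term L) : term L :=
  match t with
  | Var i => s i
  | Fun f ts => Fun f (Vector.map (tsubst s) ts)
  end.

Definition scons (u : term L) (s : nat -> term L) (i : nat) : term L :=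
  match i with 0 => u | S j => s j end.

Definition tshift : term L -> term L := tsubst (fun i => Var (S i)).

Definition tup (s : nat -> term L) : nat -> term L :=
  scons (Var 0) (fun i => tshift (s i)).

Definition tup_sort (k : sort) (s : nat -> term L) : nat -> term L :=
  match k with Ind => tup s | Prd _ => s end.

Fixpoint isubst (s : nat -> term L) (A : formula L) : formula L :=
  match A with
  | Bot => Bot
  | Pred P ts => Pred P (Vector.map (tsubst s) ts)
  | PVar n X ts => PVar n X (Vector.map (tsubst s) ts)
  | Arr B C => Arr (isubst s B) (isubst s C)
  | All k B => All k (isubst (tup_sort k s) B)
  end.

(** [A[u/y]], where [y] is individual index 0 of [A]; the other individual
    indices of [A] are lowered by one. *)
Definition iinst (A : formula L) (u : term L) : formula L :=
  isubst (scons u Var) A.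

(** ** Renaming of predicate variables *)

(** [q n] acts on the indices of [n]-ary predicate variables. *)
Definition up_pren (k : sort) (q : nat -> nat -> nat) : nat -> nat -> nat :=
  match k with
  | Ind => q
  | Prd m => fun n => if Nat.eqb n m then up_ren (q n) else q n
  end.

Fixpoint prename (q : nat -> nat -> nat) (A : formula L) : formula L :=
  match A with
  | Bot => Bot
  | Pred P ts => Pred P ts
  | PVar n X ts => PVar n (q n X) ts
  | Arr B C => Arr (prename q B) (prename q C)
  | All k B => All k (prename (up_pren k q) B)
  end.

Definition pshift (m : nat) : formula L -> formula L :=
  prename (fun n X => if Nat.eqb n m then S X else X).

(** ** Substitution of formulas for predicate variables *)

(** A formula [G] together with the chosen variables [x_1, ..., x_n] is
    represented by a formula whose individual indices [0, ..., n-1] stand for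
    [x_1, ..., x_n]; an index [n + i] stands for the variable [i] of the
    ambient scope.  [params n] is the vector [x_1, ..., x_n]. *)
Fixpoint params (n : nat) : Vector.t (term L) n :=
  match n with
  | 0 => Vector.nil (term L)
  | S m => Vector.cons (term L) (Var 0) m (Vector.map tshift (params m))
  end.

Fixpoint args_subst {n : nat} (ts : Vector.t (term L) n) : nat -> term L :=
  match ts with
  | Vector.nil _ => Var
  | Vector.cons _ t _ ts' => scons t (args_subst ts')
  end.

(** [G[t_1/x_1, ..., t_n/x_n]] *)
Definition args_inst {n : nat} (G : formula L) (ts : Vector.t (term L) n) :
    formula L :=
  isubst (args_subst ts) G.

(** A predicate substitution maps the [n]-ary variable of index [X] to a
    formula with [n] chosen variables, as above. *)
Definition pup (k : sort) (g : nat -> nat -> formula L) :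
    nat -> nat -> formula L :=
  match k with
  | Ind => fun n X => isubst (Nat.iter n tup (fun i => Var (S i))) (g n X)
  | Prd m => fun n X =>
      if Nat.eqb n m then
        match X with
        | 0 => PVar n 0 (params n)
        | S Y => pshift m (g n Y)
        end
      else pshift m (g n X)
  end.

Fixpoint psubst (g : nat -> nat -> formula L) (A : formula L) : formula L :=
  match A with
  | Bot => Bot
  | Pred P ts => Pred P ts
  | PVar n X ts => args_inst (g n X) ts
  | Arr B C => Arr (psubst g B) (psubst g C)
  | All k B => All k (psubst (pup k g) B)
  end.

(** [A[G/X]], where [X] is the [n]-ary predicate variable of index 0 of [A];
    the other [n]-ary predicate indices of [A] are lowered by one. *)
Definition pinst (n : nat) (A G : formula L) : formula L :=
  psubst (fun m X =>
            if Nat.eqb m n then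
              match X with
              | 0 => G
              | S Y => PVar m Y (params m)
              end
            else PVar m X (params m)) A.

(** ** Weakening and iterated quantification *)

(** [shift k A] is [A] in the scope of one more variable of sort [k], which is
    not free in it.  The side condition "xi is not free in A" is expressed by
    using [shift k A] in the scope of xi. *)
Definition shift (k : sort) (A : formula L) : formula L :=
  match k with
  | Ind => isubst (fun i => Var (S i)) A
  | Prd m => pshift m A
  end.

Definition shifts (ks : list sort) (A : formula L) : formula L :=
  fold_left (fun B k => shift k B) ks A.

Definition alls (ks : list sort) (A : formula L) : formula L :=
  fold_right All A ks.

(** * The relation on formulas *)

(** An equation [t = t'] of the set [E] is a pair with [E t t']. *)
Inductive particular_case (E : term L -> term L -> Prop) :
    term L -> term L -> Prop :=
| pc_direct t t' s :
    E t t' -> particular_case E (tsubst s t) (tsubst s t')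
| pc_sym t t' s :
    E t t' -> particular_case E (tsubst s t') (tsubst s t).

Inductive sub_form (E : term L -> term L -> Prop) : formula L -> formula L -> Prop :=
| sub_ax A :
    sub_form E A A
| sub_dist k C D :
    sub_form E (All k (Arr C D)) (Arr (All k C) (All k D))
| sub_arr C C' D D' :
    sub_form E C' C -> sub_form E D D' -> sub_form E (Arr C D) (Arr C' D')
| sub_all_e_ind A C u :
    sub_form E A (All Ind C) -> sub_form E A (iinst C u)
| sub_all_e_prd n A C G :
    sub_form E A (All (Prd n) C) -> sub_form E A (pinst n C G)
| sub_all_i k A D :
    sub_form E (shift k A) D -> sub_form E A (All k D)
| sub_tr A D B :
    sub_form E A D -> sub_form E D B -> sub_form E A B
| sub_eq A D u v :
    sub_form E A (iinst D u) -> particular_case E u v -> sub_form E A (iinst D v).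

(** * The typing system *)

(** A context is the list of the types of the free lambda-variables
    [0, 1, ...].  In each rule [ks] lists the sorts of the quantified sequence
    of variables, outermost first; these variables are not free in the context
    because the premises use its weakening.  In [ty_var] the declared formula
    [B] belongs to the context, hence is weakened as well. *)
Inductive typing (E : term L -> term L -> Prop) :
    list (formula L) -> lterm -> formula L -> Prop :=
| ty_var Gamma x B ks A :
    nth_error Gamma x = Some B ->
    sub_form E (alls ks (shifts ks B)) A ->
    typing E Gamma (LVar x) A
| ty_lam Gamma u B C ks A :
    typing E (B :: map (shifts ks) Gamma) u C ->
    sub_form E (alls ks (Arr B C)) A ->
    typing E Gamma (LLam u) A
| ty_app Gamma u v B C ks A :
    typing E (map (shifts ks) Gamma) u (Arr B C) ->
    typing E (map (shifts ks) Gamma) v B ->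
    sub_form E (alls ks C) A ->
    typing E Gamma (LApp u v) A.

End Formulas.

(* Main.v *)
(** In the redex [λx(t)x] the bound variable has some type [B], and the rules
    give [t : B' -> C'] with [B] included in [B'], where [B -> C] is included
    in the type of the redex and [∀ξ C'] in [C], with [ξ] not free in [B].
    Hence [t : B -> C'], so [t : ∀ξ (B -> C')] by generalization, and [(dist)]
    turns this into [∀ξ B -> ∀ξ C'], which is included in [B -> C]. *)

Require Import Defs.
From Stdlib Require Import Arith List Relations.
From Stdlib Require Vector.

Set Implicit Arguments.

Section Syntax.

Context {L : language}.

(** The induction principle generated for [term] has no hypothesis for the
    arguments of a function symbol. *)
Fixpoint term_vector_ind (P : term L -> Prop)
    (HV : forall i, P (Var i))
    (HF : forall f ts, Vector.Forall P ts -> P (Fun f ts)) (t : term L) : P t :=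
  match t with
  | Var i => HV i
  | Fun f ts =>
      HF f ts
        ((fix all n (v : Vector.t (term L) n) : Vector.Forall P v :=
            match v with
            | Vector.nil _ => Vector.Forall_nil P
            | Vector.cons _ u n w =>
                Vector.Forall_cons P u w (term_vector_ind HV HF u) (all n w)
            end) _ ts)
  end.

(** The composite is specified pointwise, which avoids equalities between functions. *)
Lemma tsubst_tsubst (s1 s2 s : nat -> term L) (t : term L) :
  (forall i, tsubst s2 (s1 i) = s i) ->
  tsubst s2 (tsubst s1 t) = tsubst s t.
Proof.
  intros Hs; induction t as [i | f ts IH] using term_vector_ind; simpl.
  - apply Hs.
  - f_equal. induction IH as [| n u w Hu _ IHw]; simpl; congruence.
Qed.

Lemma tsubst_Var (t : term L) : tsubst Var t = t.
Proof.
  induction t as [i | f ts IH] using term_vector_ind; simpl.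
  - reflexivity.
  - f_equal. induction IH as [| n u w Hu _ IHw]; simpl; congruence.
Qed.

Lemma tsubst_scons_tshift (u : term L) s t :
  tsubst (scons u s) (tshift t) = tsubst s t.
Proof. apply tsubst_tsubst; reflexivity. Qed.

Lemma tsubst_tup_tshift s (t : term L) :
  tsubst (tup s) (tshift t) = tshift (tsubst s t).
Proof.
  unfold tup; rewrite tsubst_scons_tshift.
  symmetry; apply tsubst_tsubst; reflexivity.
Qed.

Lemma tsubst_rename_cancel (r : nat -> nat) (s s' : nat -> term L) t :
  (forall i, s i = Var (r i)) -> (forall i, s' (r i) = Var i) ->
  tsubst s' (tsubst s t) = t.
Proof.
  intros Hs Hs'. rewrite <- (tsubst_Var t) at 2.
  apply tsubst_tsubst; intros i; rewrite Hs; apply Hs'.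
Qed.

(** Exposing the renaming [r] behind [s] lets the induction pass an individual quantifier with
    [up_ren r]. The use in view is weakening undone by instantiation. *)
Lemma isubst_rename_cancel (A : formula L) :
  forall (r : nat -> nat) (s s' : nat -> term L),
  (forall i, s i = Var (r i)) -> (forall i, s' (r i) = Var i) ->
  isubst s' (isubst s A) = A.
Proof.
  assert (Hv : forall (r : nat -> nat) (s s' : nat -> term L) n
                      (ts : Vector.t (term L) n),
    (forall i, s i = Var (r i)) -> (forall i, s' (r i) = Var i) ->
    Vector.map (tsubst s') (Vector.map (tsubst s) ts) = ts).
  { intros r s s' n ts Hs Hs'; induction ts as [| u n w IH]; simpl.
    - reflexivity.
    - rewrite IH, (tsubst_rename_cancel r s s') by assumption; reflexivity. }
  induction A as [| P ts | n X ts | A IHA B IHB | k A IHA];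
    intros r s s' Hs Hs'; simpl.
  - reflexivity.
  - rewrite (Hv r) by assumption; reflexivity.
  - rewrite (Hv r) by assumption; reflexivity.
  - rewrite (IHA r), (IHB r) by assumption; reflexivity.
  - f_equal. destruct k as [| m]; simpl.
    + apply (IHA (up_ren r)); intros [| i]; simpl; try reflexivity;
        [rewrite Hs | rewrite Hs']; reflexivity.
    + apply (IHA r); assumption.
Qed.

Lemma map_args_subst_params n (ts : Vector.t (term L) n) :
  Vector.map (tsubst (args_subst ts)) (params n) = ts.
Proof.
  induction ts as [| u n w IH]; simpl; [reflexivity |].
  f_equal. rewrite Vector.map_map. etransitivity; [| exact IH].
  apply Vector.map_ext; intros t; apply tsubst_scons_tshift.
Qed.

(** [n] liftings fix the indices below [n], and these are the only ones in [params n]. *)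
Lemma map_iter_tup_params n (s : nat -> term L) :
  Vector.map (tsubst (Nat.iter n tup s)) (params n) = params n.
Proof.
  induction n as [| n IH]; simpl; [reflexivity |].
  f_equal. rewrite <- IH at 2. rewrite !Vector.map_map.
  apply Vector.map_ext; intros t; apply tsubst_tup_tshift.
Qed.

(** [PVar n X (params n)] is the predicate variable [X] itself as a formula with chosen variables,
    so [g] undoes [q]; [pup] and [up_pren] preserve this relation. *)
Lemma psubst_prename_cancel (A : formula L) :
  forall (q : nat -> nat -> nat) (g : nat -> nat -> formula L),
  (forall n X, g n (q n X) = PVar n X (params n)) ->
  psubst g (prename q A) = A.
Proof.
  induction A as [| P ts | n X ts | A IHA B IHB | k A IHA];
    intros q g Hg; simpl.
  - reflexivity.
  - reflexivity.
  - rewrite Hg. unfold args_inst; simpl.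
    rewrite map_args_subst_params; reflexivity.
  - rewrite IHA, IHB by assumption; reflexivity.
  - f_equal. apply IHA; intros n X. destruct k as [| m]; simpl.
    + rewrite Hg; simpl. rewrite map_iter_tup_params; reflexivity.
    + destruct (Nat.eqb n m) eqn:Hnm.
      * destruct X as [| X]; simpl; [reflexivity |].
        rewrite Hg; unfold pshift; simpl; rewrite Hnm; reflexivity.
      * rewrite Hg; unfold pshift; simpl; rewrite Hnm; reflexivity.
Qed.

Lemma alls_app ks ks' (A : formula L) : alls (ks ++ ks') A = alls ks (alls ks' A).
Proof. apply fold_right_app. Qed.

Lemma shifts_app ks ks' (A : formula L) :
  shifts (ks ++ ks') A = shifts ks' (shifts ks A).
Proof. apply fold_left_app. Qed.

End Syntax.

Section Inclusion.

Context {L : language}.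
Variable E : term L -> term L -> Prop.

(** Instantiating the bound variable by the variable itself. *)
Lemma sub_shift_All k (C : formula L) : sub_form E (shift k (All k C)) C.
Proof.
  destruct k as [| m]; simpl.
  - pose proof (sub_all_e_ind (Var 0)
      (sub_ax E (All Ind (isubst (tup (fun i => Var (S i))) C)))) as H.
    unfold iinst in H.
    rewrite (isubst_rename_cancel C (up_ren S)) in H; [exact H | |];
      intros [| i]; reflexivity.
  - pose proof (sub_all_e_prd (PVar m 0 (params m))
      (sub_ax E (All (Prd m) (prename
         (up_pren (Prd m) (fun n X => if Nat.eqb n m then S X else X)) C)))) as H.
    unfold pinst in H.
    rewrite psubst_prename_cancel in H; [exact H |].
    intros n X; simpl.
    destruct (Nat.eqb n m) eqn:Hnm; [| reflexivity].
    apply Nat.eqb_eq in Hnm; subst n.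
    destruct X; reflexivity.
Qed.

Lemma sub_All k (C D : formula L) :
  sub_form E C D -> sub_form E (All k C) (All k D).
Proof.
  intros H; apply sub_all_i; eapply sub_tr; [apply sub_shift_All | exact H].
Qed.

Lemma sub_alls ks (C D : formula L) :
  sub_form E C D -> sub_form E (alls ks C) (alls ks D).
Proof. intros H; induction ks; simpl; [exact H | now apply sub_All]. Qed.

Lemma sub_alls_Arr ks (C D : formula L) :
  sub_form E (alls ks (Arr C D)) (Arr (alls ks C) (alls ks D)).
Proof.
  induction ks as [| k ks IH]; simpl; [apply sub_ax |].
  eapply sub_tr; [apply sub_All, IH | apply sub_dist].
Qed.

(** Vacuous quantification: [shifts] and [alls] both treat the outermost variable first, so each
    weakening matches one use of [sub_all_i]. *)
Lemma sub_alls_shifts ks (B : formula L) :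
  sub_form E B (alls ks (shifts ks B)).
Proof.
  revert B; induction ks as [| k ks IH]; intros B; simpl; [apply sub_ax |].
  apply sub_all_i, IH.
Qed.

End Inclusion.

Section Typing.

Context {L : language}.
Variable E : term L -> term L -> Prop.

(** Every rule ends with an inclusion into its type, which absorbs a further one by transitivity. *)
Lemma typing_sub Gamma t (A B : formula L) :
  typing E Gamma t A -> sub_form E A B -> typing E Gamma t B.
Proof.
  intros [] Hs; [eapply ty_var | eapply ty_lam | eapply ty_app]; eauto;
    eapply sub_tr; eauto.
Qed.

(** Generalization is admissible: [ks] is put in front of the sequence quantified by the last
    rule. *)
Lemma typing_alls ks Gamma t (A : formula L) :
  typing E (map (shifts ks) Gamma) t A -> typing E Gamma t (alls ks A).
Proof.
  assert (Hmap : forall ks', map (shifts ks') (map (shifts ks) Gamma)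
                             = map (shifts (ks ++ ks')) Gamma).
  { intros ks'; rewrite map_map; apply map_ext; intros B.
    symmetry; apply shifts_app. }
  inversion 1 as [? x B ks' ? Hx Hs | ? u B C ks' ? Hu Hs
                 | ? u v B C ks' ? Hu Hv Hs]; subst.
  - rewrite nth_error_map in Hx.
    destruct (nth_error Gamma x) as [B0 |] eqn:HB; [| discriminate].
    injection Hx as <-.
    apply ty_var with (B := B0) (ks := ks ++ ks'); [exact HB |].
    rewrite alls_app, shifts_app; now apply sub_alls.
  - rewrite Hmap in Hu.
    apply ty_lam with (1 := Hu).
    rewrite alls_app; now apply sub_alls.
  - rewrite Hmap in Hu, Hv.
    apply ty_app with (1 := Hu) (2 := Hv).
    rewrite alls_app; now apply sub_alls.
Qed.

(** A derivation consults the context only at free variables. With [r] equal to [S] this is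
    strengthening, which discards the declaration of the variable bound in an eta-redex. *)
Lemma typing_lrename_inv t :
  forall (r : nat -> nat) Gamma Delta (A : formula L),
  typing E Gamma (lrename r t) A ->
  (forall x, nth_error Gamma (r x) = nth_error Delta x) ->
  typing E Delta t A.
Proof.
  assert (Hmap : forall (r : nat -> nat) (Gamma Delta : list (formula L)) ks,
    (forall x, nth_error Gamma (r x) = nth_error Delta x) ->
    forall x, nth_error (map (shifts ks) Gamma) (r x)
              = nth_error (map (shifts ks) Delta) x).
  { intros r Gamma Delta ks Hr x; rewrite !nth_error_map, Hr; reflexivity. }
  induction t as [y | t IH | t1 IH1 t2 IH2]; simpl; intros r Gamma Delta A HA Hr;
    inversion HA as [? ? B ks ? Hx Hs | ? ? B C ks ? Hu Hs
                    | ? ? ? B C ks ? Hu Hv Hs]; subst.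
  - rewrite Hr in Hx; eapply ty_var; eauto.
  - eapply ty_lam; [| exact Hs].
    eapply IH; [exact Hu |].
    intros [| x]; simpl; [reflexivity | now apply Hmap].
  - eapply ty_app; [| | exact Hs]; eauto.
Qed.

Lemma typing_eta_contract Gamma t (A : formula L) :
  typing E Gamma (LLam (LApp (lrename S t) (LVar 0))) A -> typing E Gamma t A.
Proof.
  inversion 1 as [| ? ? B C ks ? Hu HA |]; subst.
  inversion Hu as [| | ? ? ? B' C' ks' ? Ht H0 HC]; subst.
  inversion H0 as [? ? B0 ks0 ? HB0 HB' | |]; subst.
  (* Index 0 is the bound variable; the application rule has weakened its type to [shifts ks' B]. *)
  simpl in HB0; injection HB0 as <-.
  apply typing_sub with (2 := HA), typing_alls.
  (* The whole arrow is generalized over [ks'], since [C'] may depend on these variables;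
     distribution then recovers [Arr B C]. *)
  apply typing_sub with (alls ks' (Arr (shifts ks' B) C')).
  - apply typing_alls.
    apply typing_sub with (Arr B' C').
    + apply typing_lrename_inv with (1 := Ht); reflexivity.
    + apply sub_arr; [| apply sub_ax].
      eapply sub_tr; [apply sub_alls_shifts | exact HB'].
  - eapply sub_tr; [apply sub_alls_Arr |].
    apply sub_arr; [apply sub_alls_shifts | exact HC].
Qed.

(** Context and type stay general in the induction because premises type subterms in weakened or
    extended contexts. *)
Lemma typing_eta_step t t' :
  eta_step t t' ->
  forall Gamma (A : formula L), typing E Gamma t A -> typing E Gamma t' A.
Proof.
  induction 1; intros Gamma A HA; [now apply typing_eta_contract | ..];
    inversion HA; subst; [eapply ty_lam | eapply ty_app ..]; eauto.
Qed.

End Typing.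

Theorem theorem6 (L : language) (E : term L -> term L -> Prop)
    (Gamma : list (formula L)) (t t' : lterm) (A : formula L) :
  typing E Gamma t A -> eta_red t t' -> typing E Gamma t' A.
Proof.
  intros HA Hred; revert HA.
  induction Hred; eauto using typing_eta_step.
Qed.
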